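(* Let $\mathcal{H}$ be a real Hilbert space and $T:\mathcal{H}\to\mathcal{H}$ a nonexpansive operator with $\mathrm{Fix}\,T\ne\emptyset$. Let $0<q<1$, $\alpha>1$, $b>0$ with $\alpha-1<b^q$. For given $x_0,v\in\mathcal{H}$, let $(x_k)_{k\ge0}$ be generated by $$x_{k+1}:=\frac{\alpha-1}{(k+b)^q}\,v+\left(1-\frac{\alpha-1}{(k+b)^q}\right)T(x_k)\quad\forall k\ge0 .$$ Then the following statements are true: (i) as $k\to+\infty$ it holds $$\|x_{k+1}-x_k\|=\mathcal{O}\left(\frac{1}{k+b+1}\right),\qquad\|x_{k+1}-T(x_{k+1})\|=\mathcal{O}\left(\frac{1}{(k+b)^q}\right);$$ (ii) $(x_k)_{k\ge0}$ converges strongly to $\xi_*:=P_{\mathrm{Fix}\,T}(v)$ as $k\to+\infty$.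
   Context: $T$ is nonexpansive if $\|T(x)-T(y)\|\le\|x-y\|$ for all $x,y\in\mathcal{H}$. $\mathrm{Fix}\,T:=\{x\in\mathcal{H}:x=T(x)\}$, which is closed and convex; $P_{\mathrm{Fix}\,T}$ denotes the metric projection onto it. *)

(* Defs.v *)
From HB Require Import structures.
From mathcomp Require Import all_boot all_order all_algebra.
From mathcomp Require Import all_classical all_reals all_analysis.

Set Implicit Arguments.
Unset Strict Implicit.
Unset Printing Implicit Defensive.

Import Order.TTheory GRing.Theory Num.Theory.
Import numFieldNormedType.Exports.

Local Open Scope classical_set_scope.
Local Open Scope ring_scope.

Definition nonexpansive (R : realType) (H : normedModType R) (T : H -> H) :=
  forall x y : H, `|T x - T y| <= `|x - y|.

Definition Fix (X : Type) (T : X -> X) : set X := [set x | x = T x].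

Definition nearest_points (R : realType) (H : normedModType R)
    (C : set H) (v : H) : set H :=
  [set p | C p /\ forall y, C y -> `|v - p| <= `|v - y|].

(* The metric projection is made total by choice.  When [C] is a nonempty
   closed convex subset of a Hilbert space, [nearest_points C v] is a singleton
   and this is its unique element. *)
Definition metric_projection (R : realType) (H : normedModType R)
    (C : set H) (v : H) : H :=
  get (nearest_points C v).

(* Main.v *)
Require Import Defs.
From HB Require Import structures.
From mathcomp Require Import all_boot all_order all_algebra.
From mathcomp Require Import all_classical all_reals all_analysis.
From mathcomp Require Import ring lra.

Import Order.TTheory GRing.Theory Num.Theory.
Import numFieldNormedType.Exports.

Local Open Scope classical_set_scope.
Local Open Scope ring_scope.

(** Write [t k = (alpha - 1) / (k + b) ^ q]; these weights lie in (0, 1),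
    decrease to [0], and satisfy [t k - t (k + 1) <= t (k + 1) / (k + b)]
    because [q < 1].

    Rates.  The iterates stay in a ball around a fixed point, so
    [`|v - T (x k)| <= M].  Subtracting two successive steps gives, for
    [d k = `|x (k + 1) - x k|],
    [d (k + 1) <= (1 - t (k + 1)) d k + (t k - t (k + 1)) M],
    where the last term is [t (k + 1) O(1 / (k + b + 1))]
    ([halpern_step_le], [step_sub_le]).  Since [t k (k + b)] tends to infinity,
    induction yields [d k = O(1 / (k + b + 1))] ([recursion_rate]).  The
    residual at [x (k + 1)] is at most [t k `|v - T (x k)| + d k], of order
    [1 / (k + b) ^ q].

    Convergence.  Let [z k] be the solution of
    [z k = t k v + (1 - t k) T (z k)].  One step from [x k] contracts by
    [1 - t k] towards [z k], hence [t k `|x k - z k| <= d k]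
    ([dist_anchored_point_le]), and the rate of [d] gives [x k - z k --> 0].  It
    remains to see that [z k] converges to the projection of [v] on [Fix T]
    ([anchored_cvg]).  Monotonicity of [id - T] gives
    [`|z k - z l| ^ 2 <= `|v - z l| ^ 2 - `|v - z k| ^ 2] for [k <= l], and the
    same with a fixed point in place of [z l] ([anchored_dist_le]); strong
    convergence follows without any weak compactness argument. *)

(** * Curve of anchored points *)

Lemma sub_anchor {R : realType} {V : lmodType R} {t : R} {v w z : V} :
  z = t *: v + (1 - t) *: w -> z - v = (1 - t) *: (w - v).
Proof.
move=> ->; rewrite scalerBr [(1 - t) *: v]scalerBl scale1r opprB addrA.
by rewrite [_ *: w + _]addrC.
Qed.

(** The points anchored at [v] with weight [t] solve [z = t v + (1 - t) T z].
    For weights [s < t], the points [y] and [z] have [<v - z, y - z> <= 0]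
    because [id - T] is monotone.  The case [s = 0] compares [z] with a fixed
    point [y] of [T]. *)
Lemma anchored_dist_le {R : realType} {H : normedModType R}
    {dotp : {dot H for idfun}} (dotpE : forall u : H, dotp u u = `|u| ^+ 2)
    {T : H -> H} (Tne : nonexpansive T) {v z y : H} {s t : R} :
  0 <= s -> s < t -> t < 1 ->
  z = t *: v + (1 - t) *: T z -> y = s *: v + (1 - s) *: T y ->
  `|z - y| ^+ 2 <= `|v - y| ^+ 2 - `|v - z| ^+ 2.
Proof.
move=> s0 st t1 /sub_anchor zE /sub_anchor yE.
have dotC a c : dotp a c = dotp c a by rewrite hermC expr0 mul1r.
have sqB (a c : H) : `|a - c| ^+ 2 = `|a| ^+ 2 - dotp a c *+ 2 + `|c| ^+ 2.
  by rewrite -!dotpE linearBl /= !linearBr /= (dotC c a); ring.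
have Zsq k (a : H) : `|k *: a| ^+ 2 = k ^+ 2 * `|a| ^+ 2.
  by rewrite normrZ exprMn real_normK ?num_real.
pose a := T z - v; pose c := T y - v.
rewrite (distrC v y) (distrC v z).
have subE (e f : H) : e - f = (e - v) - (f - v) by rewrite opprB addrA subrK.
(* Since z - v = (1 - t) a and y - v = (1 - s) c, the three facts below speak
   of |a|^2, |c|^2 and <a, c> only; the first two added together express
   <a - c, z - y> <= |z - y|^2, which is the monotonicity of id - T. *)
have : `|a - c| ^+ 2 <= `|z - y| ^+ 2.
  by rewrite ler_sqr ?nnegrE // /a /c -subE; exact: Tne.
have : 0 <= `|(z - y) - (a - c)| ^+ 2 by exact: sqr_ge0.
have : 0 <= `|z - y| ^+ 2 by exact: sqr_ge0.
rewrite -/a in zE; rewrite -/c in yE.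
rewrite [`|_ - (a - c)| ^+ 2]sqB (subE z y) zE yE -/a -/c.
rewrite (sqB a) (sqB (_ *: a)).
clearbody a c.
rewrite !linearBl /= !linearBr /= !linearZl_LR /= !linearZr_LR /= !dotpE !Zsq.
rewrite (dotC c a).
set A := `|a| ^+ 2; set C := `|c| ^+ 2; set D := dotp a c.
rewrite /GRing.scale /= => h1 h2 h3.
pose X := (1 - t) * A - (1 - s) * D; pose Y := (1 - s) * C - (1 - t) * D.
have hXY : 0 <= (1 - t) * X + (1 - s) * Y by move: h1; rewrite /X /Y; lra.
have hXY' : t * X + s * Y <= 0 by move: h2 h3; rewrite /X /Y; lra.
(* eliminating Y leaves (t - s) * X <= 0 *)
have X0 : X <= 0.
  have h4 : (t - s) * X <= 0 by nra.
  by rewrite pmulr_rle0 // subr_gt0 in h4.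
by rewrite /X in X0; nra.
Qed.

(** The right-hand side is a contraction of ratio [1 - t] in [z]. *)
Lemma anchored_point_exists {R : realType} {H : completeNormedModType R}
    {T : H -> H} (Tne : nonexpansive T) (v : H) {t : R} :
  0 < t -> t < 1 -> exists z, z = t *: v + (1 - t) *: T z.
Proof.
move=> t0 t1.
pose f z := t *: v + (1 - t) *: T z.
have t1' : 0 <= 1 - t by lra.
suff [z _ zE] : exists2 z, [set: H] z & z = totalfun f z by exists z.
apply: (@banach_fixed_point R H [set: H]) => //; last by exists v.
exists (NngNum t1'); split => /=; first by lra.
move=> [a c] _; rewrite /= /totalfun /f opprD addrACA subrr add0r -scalerBr.
by rewrite normrZ ger0_norm // ler_wpM2l.
Qed.

(** As the weights decrease to [0], [`|v - z k| ^+ 2] increases and stays below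
    the squared distance from [v] to any fixed point, so it converges, and
    [anchored_dist_le] makes [z] a Cauchy sequence.  Its limit is a fixed point
    nearest to [v].  The same inequality at the chosen nearest point identifies
    the limit, so that neither convexity of [Fix T] nor uniqueness of the
    projection has to be established separately. *)
Lemma anchored_cvg {R : realType} {H : completeNormedModType R}
    {dotp : {dot H for idfun}} (dotpE : forall u : H, dotp u u = `|u| ^+ 2)
    {T : H -> H} (Tne : nonexpansive T) (FixT0 : Fix T !=set0) {v : H}
    {t : nat -> R} {z : nat -> H} :
  (forall k, 0 < t k < 1) -> (forall k l, (k < l)%N -> t l < t k) ->
  t @ \oo --> (0 : R) ->
  (forall k, z k = t k *: v + (1 - t k) *: T (z k)) ->
  z @ \oo --> metric_projection (Fix T) v.
Proof.
move=> t01 tdec t0 zE.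
have t_gt0 k : 0 < t k by have /andP[] := t01 k.
have t_lt1 k : t k < 1 by have /andP[] := t01 k.
have Fz y k : Fix T y -> `|z k - y| ^+ 2 <= `|v - y| ^+ 2 - `|v - z k| ^+ 2.
  move=> Ty; apply: (anchored_dist_le dotpE Tne (lexx 0) (t_gt0 k)) => //.
  by rewrite scale0r add0r subr0 scale1r.
have zz k l : (k <= l)%N ->
    `|z k - z l| ^+ 2 <= `|v - z l| ^+ 2 - `|v - z k| ^+ 2.
  rewrite leq_eqVlt => /predU1P[->|kl]; first by rewrite !subrr normr0 expr0n.
  exact: (anchored_dist_le dotpE Tne (ltW (t_gt0 l)) (tdec _ _ kl)).
pose U k := `|v - z k| ^+ 2.
have Uh k l : (k <= l)%N -> U k <= U l.
  by move=> /zz h; rewrite -subr_ge0; apply: le_trans h; exact: sqr_ge0.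
have [y0 Fy0] := FixT0.
have Ub y k : Fix T y -> U k <= `|v - y| ^+ 2.
  by move=> /Fz h; rewrite -subr_ge0; apply: le_trans (h k); exact: sqr_ge0.
have Ucvg : cvgn U.
  apply: nondecreasing_is_cvgn => //; exists (`|v - y0| ^+ 2).
  by move=> _ [k _ <-]; exact: Ub.
have zcvg : cvgn z.
  apply: cauchy_cvg; apply: cauchy_exP => e e0.
  have /cvgrPdist_lt/(_ (e ^+ 2)) := Ucvg.
  rewrite exprn_gt0 // => /(_ isT) [N _ hN].
  exists (z N); exists N => // k /= Nk.
  rewrite -ball_normE /= -ltr_sqr ?nnegrE //; last exact: ltW.
  apply: le_lt_trans (zz _ _ Nk) _.
  have := hN N (leqnn N); rewrite /= => /ltr_normlW.
  have := nondecreasing_cvgn_le Uh Ucvg k; rewrite /U => h1 h2.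
  by apply: le_lt_trans h2; rewrite lerB.
pose p := limn z.
have zp : z @ \oo --> p by exact: zcvg.
have Up : U @ \oo --> `|v - p| ^+ 2.
  apply: cvgM; apply: cvg_norm; apply: cvgB => //; exact: cvg_cst.
have Upb y : Fix T y -> `|v - p| <= `|v - y|.
  move=> Fy; rewrite -ler_sqr ?nnegrE //.
  have <- : limn U = `|v - p| ^+ 2 by exact: cvg_lim.
  by apply: limr_le => //; near=> k; exact: Ub.
have Tcont : continuous T.
  move=> a; apply/cvgrPdist_lt => e e0; near=> c.
  by apply: le_lt_trans (Tne _ _) _; near: c; exact: cvgr_dist_lt.
have Fp : Fix T p.
  have Tz : T \o z @ \oo --> T p by apply: continuous_cvg => //; exact: Tcont.
  have : (fun k => t k *: v + (1 - t k) *: T (z k)) @ \oo -->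
      0 *: v + (1 - 0) *: T p.
    apply: cvgD; first by apply: cvgZ => //; exact: cvg_cst.
    by apply: cvgZ => //; apply: cvgB => //; exact: cvg_cst.
  rewrite scale0r add0r subr0 scale1r -(funext zE) => h.
  exact: (cvg_unique _ zp h).
have [FP hP] : nearest_points (Fix T) v (metric_projection (Fix T) v).
  by apply: (@getPex _ (nearest_points (Fix T) v)); exists p.
set P := metric_projection _ _ in FP hP *.
have PE : `|v - P| = `|v - p| by apply/eqP; rewrite eq_le hP //= Upb.
apply/cvgrPdist_lt => e e0.
have /cvgrPdist_lt/(_ (e ^+ 2)) := Up; rewrite exprn_gt0 // => /(_ isT) h.
near=> k.
rewrite distrC -ltr_sqr ?nnegrE //; last exact: ltW.
apply: le_lt_trans (Fz _ _ FP) _; rewrite PE.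
apply: ltr_normlW; near: k; exact: h.
Unshelve. all: by end_near.
Qed.

(** * Weights and the scalar recursion *)

Lemma near_natD_powR_ge {R : realType} {b r : R} (A : R) :
  0 < b -> 0 < r -> \forall k \near \oo, A <= (k%:R + b) `^ r.
Proof.
move=> b0 r0; near=> k.
have A0 : 0 <= `|A| by [].
apply: (le_trans (ler_norm A)).
have -> : `|A| = (`|A| `^ r^-1) `^ r.
  by rewrite -powRrM mulVf ?gt_eqF // powRr1.
have kA : `|A| `^ r^-1 <= k%:R by near: k; exact: nbhs_infty_ger.
apply: ge0_ler_powR; rewrite ?nnegrE ?powR_ge0 ?(ltW r0) //.
  by rewrite addr_ge0 // ltW.
by apply: le_trans kA _; lra.
Unshelve. all: by end_near.
Qed.

Lemma natD_gt0 {R : realType} {b : R} (b_gt0 : 0 < b) (k : nat) : 0 < k%:R + b.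
Proof. by rewrite ltr_wpDl. Qed.

(** The weights [a / (k + b) ^ q] of the iteration. *)
Definition step_size {R : realType} (q a b : R) (k : nat) : R :=
  a / (k%:R + b) `^ q.

Lemma step_gt0 {R : realType} {q a b : R} (a_gt0 : 0 < a) (b_gt0 : 0 < b) k :
  0 < step_size q a b k.
Proof. by rewrite divr_gt0 // powR_gt0 // natD_gt0. Qed.

Lemma step_decr {R : realType} {q a b : R}
    (q_gt0 : 0 < q) (a_gt0 : 0 < a) (b_gt0 : 0 < b) k l :
  (k < l)%N -> step_size q a b l < step_size q a b k.
Proof.
move=> kl; rewrite ltr_pM2l // ltf_pV2 ?posrE ?powR_gt0 ?(natD_gt0 b_gt0) //.
by apply: gt0_ltr_powR; rewrite // ?nnegrE ?ltW ?(natD_gt0 b_gt0) //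
  ltrD2r ltr_nat.
Qed.

(** A mean-value bound for [s |-> s ^ (- q)], which follows from
    [(1 + 1 / s) ^ q <= 1 + 1 / s]. *)
Lemma step_sub_le {R : realType} {q a b : R}
    (q_gt0 : 0 < q) (q_lt1 : q < 1) (a_gt0 : 0 < a) (b_gt0 : 0 < b) k :
  step_size q a b k - step_size q a b k.+1 <= step_size q a b k.+1 / (k%:R + b).
Proof.
have s0 := natD_gt0 b_gt0 k; have t0 := natD_gt0 b_gt0 k.+1.
set s := k%:R + b in s0 *; set t := k.+1%:R + b in t0 *.
have ts : t = s + 1 by rewrite /t /s -natr1; ring.
rewrite /step_size -/s -/t.
have sq0 : 0 < s `^ q by rewrite powR_gt0.
have tq0 : 0 < t `^ q by rewrite powR_gt0.
have hq : t `^ q <= s `^ q * (t / s).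
  have -> : t `^ q = s `^ q * (t / s) `^ q.
    by rewrite -powRM ?ltW ?divr_gt0 // mulrC divfK // gt_eqF.
  rewrite ler_pM2l //; apply: ler1_powR; last exact: ltW.
  by rewrite ler_pdivlMr // mul1r ts; lra.
have -> : a / s `^ q - a / t `^ q = a / t `^ q * (t `^ q / s `^ q - 1).
  by field; rewrite !gt_eqF.
rewrite ler_pM2l ?divr_gt0 // lerBlDr.
have -> : s^-1 + 1 = t / s by rewrite ts; field; rewrite gt_eqF.
by rewrite ler_pdivrMr // mulrC.
Qed.

Lemma step_cvg0 {R : realType} {q a b : R}
    (q_gt0 : 0 < q) (a_gt0 : 0 < a) (b_gt0 : 0 < b) :
  step_size q a b @ \oo --> (0 : R).
Proof.
apply/cvgrPdist_le => e e0; near=> k.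
rewrite sub0r normrN ger0_norm; last by rewrite ltW // step_gt0.
rewrite ler_pdivrMr ?powR_gt0 ?(natD_gt0 b_gt0) // mulrC -ler_pdivrMr //.
near: k; exact: near_natD_powR_ge.
Unshelve. all: by end_near.
Qed.

(** The weights decay strictly slower than [1 / (k + b)]; both the rate and the
    convergence rest on this. *)
Lemma near_step_mul_ge {R : realType} {q a b : R}
    (q_lt1 : q < 1) (a_gt0 : 0 < a) (b_gt0 : 0 < b) A :
  \forall k \near \oo, A <= step_size q a b k * (k%:R + b).
Proof.
have q1 : 0 < 1 - q by rewrite subr_gt0.
near=> k.
have -> : step_size q a b k * (k%:R + b) = a * (k%:R + b) `^ (1 - q).
  rewrite powRB; last by rewrite (gt_eqF (natD_gt0 b_gt0 k)) implybT.
  by rewrite powRr1 ?ltW ?(natD_gt0 b_gt0) // /step_size; ring.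
rewrite mulrC -ler_pdivrMr //.
near: k; exact: near_natD_powR_ge.
Unshelve. all: by end_near.
Qed.

Lemma inv_natD1_le {R : realType} {q b : R}
    (q_gt0 : 0 < q) (q_lt1 : q < 1) (b_gt0 : 0 < b) k :
  1 / (k%:R + b + 1) <= 1 / (k%:R + b) `^ q.
Proof.
have s0 := natD_gt0 b_gt0 k.
have s1 : 0 < k%:R + b + 1 by lra.
rewrite !div1r lef_pV2 ?posrE ?powR_gt0 //.
apply: (@le_trans _ _ ((k%:R + b + 1) `^ q)).
  by apply: ge0_ler_powR; rewrite ?nnegrE; lra.
by apply: ler1_powR; [rewrite lerDr ltW|exact: ltW].
Qed.

(** The claim [d k <= D / (k + b + 1)] propagates as soon as
    [beta (k + b) >= 2] and [D >= 2 C]: half of the contraction factor absorbs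
    the perturbation [C], the other half the decrease from [1 / (k + b + 1)] to
    [1 / (k + b + 2)]. *)
Lemma recursion_rate {R : realType} (b C : R) (beta d : nat -> R) :
  0 < b -> (forall k, 0 < beta k < 1) -> (forall k, 0 <= d k) ->
  (forall A : R, \forall k \near \oo, A <= beta k * (k%:R + b)) ->
  (forall k,
     d k.+1 <= (1 - beta k.+1) * d k + beta k.+1 * (C / (k%:R + b + 1))) ->
  exists2 D, 0 < D & \forall k \near \oo, d k <= D * (1 / (k%:R + b + 1)).
Proof.
move=> b0 beta01 d0 /(_ 2)[N _ hN] drec.
have s0 k : 0 < k%:R + b + 1 :> R by rewrite addr_gt0 // ltr_wpDl.
(* D dominates 2 * C, and is large enough for the bound to hold at index N *)
pose D := `|2 * C| + d N * (N%:R + b + 1) + 1.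
have dN : 0 <= d N * (N%:R + b + 1) by rewrite mulr_ge0 // ltW.
have CD : 2 * C <= D by have := ler_norm (2 * C); rewrite /D; lra.
have D_gt0 : 0 < D by have := normr_ge0 (2 * C); rewrite /D; lra.
exists D => //.
have base : d N <= D * (1 / (N%:R + b + 1)).
  rewrite mulrA mulr1 ler_pdivlMr //.
  by have := normr_ge0 (2 * C); rewrite /D; lra.
exists N => // k /=; elim: k => [|k IH]; first by rewrite leqn0 => /eqP <-.
rewrite leq_eqVlt => /predU1P[<- //|Nk].
have {}IH := IH Nk; apply: le_trans (drec k) _.
have := hN k.+1 (leqW Nk) => /=; have /andP[] := beta01 k.+1.
set be := beta k.+1 => be0 be1.
rewrite -(natr1 k); set s := k%:R + b + 1 in IH * => hbe.
have sp : 0 < s := s0 k.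
have s1E : k%:R + 1 + b + 1 = s + 1 by rewrite /s; ring.
have hbs : 2 <= be * s by move: hbe; rewrite addrAC.
rewrite s1E.
apply: (@le_trans _ _ ((1 - be) * (D * (1 / s)) + be * (C / s))).
  by rewrite lerD2r ler_wpM2l // subr_ge0 ltW.
have -> : (1 - be) * (D * (1 / s)) + be * (C / s) = (D - be * (D - C)) / s.
  by field; rewrite gt_eqF.
rewrite mulrA mulr1 ler_pdivrMr // mulrAC ler_pdivlMr; last by lra.
have h1 : be * D <= 2 * (be * (D - C)) by nra.
have h2 : 2 * D <= be * s * D by nra.
by nra.
Qed.

(** * The anchored iteration *)

(** The iterates stay in a ball around any fixed point. *)
Lemma halpern_dist_le {R : realType} {H : normedModType R} {T : H -> H}
    (Tne : nonexpansive T) {v y : H} {t : nat -> R} {x : nat -> H} :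
  Fix T y -> (forall k, 0 < t k < 1) ->
  (forall k, x k.+1 = t k *: v + (1 - t k) *: T (x k)) ->
  forall k, `|x k - y| <= Num.max `|x 0%N - y| `|v - y|.
Proof.
move=> Ty t01 xE; elim=> [|k IH]; first by rewrite le_max lexx.
set B := Num.max _ _ in IH *; have /andP[/ltW t0 /ltW t1] := t01 k.
have vB : `|v - y| <= B by rewrite le_max lexx orbT.
have TB : `|T (x k) - y| <= B by rewrite {1}Ty; apply: le_trans (Tne _ _) IH.
have -> : x k.+1 - y = t k *: (v - y) + (1 - t k) *: (T (x k) - y).
  rewrite xE !scalerBr addrACA -opprD -scalerDl.
  by rewrite [t k + _]addrC subrK scale1r.
apply: le_trans (ler_normD _ _) _; rewrite !normrZ.
rewrite (ger0_norm t0) (@ger0_norm _ (1 - t k)) ?subr_ge0 //.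
have -> : B = t k * B + (1 - t k) * B by ring.
by rewrite lerD // ler_wpM2l // subr_ge0.
Qed.

Lemma halpern_anchor_dist_le {R : realType} {H : normedModType R} {T : H -> H}
    (Tne : nonexpansive T) {v y : H} {t : nat -> R} {x : nat -> H} :
  Fix T y -> (forall k, 0 < t k < 1) ->
  (forall k, x k.+1 = t k *: v + (1 - t k) *: T (x k)) ->
  exists2 M, 0 <= M & forall k, `|v - T (x k)| <= M.
Proof.
move=> Ty t01 xE.
exists (`|v - y| + Num.max `|x 0%N - y| `|v - y|) => [|k].
  by rewrite addr_ge0 // le_max normr_ge0.
apply: le_trans (ler_distD y _ _) _; rewrite lerD2l distrC {1}Ty.
exact: le_trans (Tne _ _) (halpern_dist_le Tne Ty t01 xE k).
Qed.

(** Two successive steps, started at [w] and [w'] with weights [s] and [t]. *)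
Lemma halpern_step_le {R : realType} {H : normedModType R} {T : H -> H}
    (Tne : nonexpansive T) {v w w' x1 x2 : H} {s t : R} :
  t <= s -> t < 1 ->
  x1 = s *: v + (1 - s) *: T w -> x2 = t *: v + (1 - t) *: T w' ->
  `|x2 - x1| <= (1 - t) * `|w' - w| + (s - t) * `|v - T w|.
Proof.
move=> ts /ltW t1 x1E x2E.
have -> : x2 - x1 = (1 - t) *: (T w' - T w) - (s - t) *: (v - T w).
  have -> : x2 - x1 = (x2 - v) - (x1 - v) by rewrite opprB addrA subrK.
  rewrite (sub_anchor x1E) (sub_anchor x2E).
  have -> : T w' - v = (T w' - T w) + (T w - v) by rewrite addrA subrK.
  rewrite scalerDr -addrA -scalerBl -[v - T w]opprB scalerN opprK.
  by congr (_ + _ *: _); ring.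
apply: le_trans (ler_normB _ _) _; rewrite !normrZ.
rewrite (@ger0_norm _ (1 - t)) ?subr_ge0 // (@ger0_norm _ (s - t)) ?subr_ge0 //.
by rewrite lerD2r ler_wpM2l ?subr_ge0.
Qed.

(** A step from [w] moves it by at least [t] times its distance to the anchored
    point with the same weight, since the step contracts by [1 - t] towards
    that point. *)
Lemma dist_anchored_point_le {R : realType} {H : normedModType R} {T : H -> H}
    (Tne : nonexpansive T) {v w x z : H} {t : R} :
  t < 1 -> x = t *: v + (1 - t) *: T w -> z = t *: v + (1 - t) *: T z ->
  t * `|w - z| <= `|x - w|.
Proof.
move=> t1 xE zE.
have := halpern_step_le Tne (lexx t) t1 zE xE.
rewrite subrr mul0r addr0 => h.
have := ler_distD x w z; rewrite (distrC w x); lra.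
Qed.

(** * Rates and strong convergence *)

Theorem theorem4p5 (R : realType) (H : completeNormedModType R)
  (dotp : {dot H for idfun}) (dotpE : forall u : H, dotp u u = `|u| ^+ 2)
  (T : H -> H) (T_nonexpansive : nonexpansive T) (FixT_neq0 : Fix T !=set0)
  (q alpha b : R) (q_gt0 : 0 < q) (q_lt1 : q < 1) (alpha_gt1 : 1 < alpha)
  (b_gt0 : 0 < b) (alpha_b : alpha - 1 < b `^ q)
  (x0 v : H) (x : nat -> H) (x_init : x 0%N = x0)
  (x_step : forall k : nat,
    x k.+1 = ((alpha - 1) / (k%:R + b) `^ q) *: v
             + (1 - (alpha - 1) / (k%:R + b) `^ q) *: T (x k)) :
  [/\ (fun k : nat => `|x k.+1 - x k|) =O_\oo
        (fun k : nat => 1 / (k%:R + b + 1)),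
      (fun k : nat => `|x k.+1 - T (x k.+1)|) =O_\oo
        (fun k : nat => 1 / (k%:R + b) `^ q)
    & x @ \oo --> metric_projection (Fix T) v].
Proof.
pose a := alpha - 1; have a_gt0 : 0 < a by rewrite subr_gt0.
pose t := step_size q a b.
have t_gt0 k : 0 < t k := step_gt0 a_gt0 b_gt0 k.
have t_decr k l : (k < l)%N -> t l < t k := step_decr q_gt0 a_gt0 b_gt0 k l.
have t_lt1 k : t k < 1.
  apply: (@le_lt_trans _ _ (t 0%N)).
    by case: k => [//|k]; exact/ltW/t_decr.
  by rewrite /t /step_size add0r ltr_pdivrMr ?powR_gt0 // mul1r.
have t01 k : 0 < t k < 1 by rewrite t_gt0 t_lt1.
have xE k : x k.+1 = t k *: v + (1 - t k) *: T (x k) := x_step k.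
have [y Fy] := FixT_neq0.
have [M M_ge0 vM] := halpern_anchor_dist_le T_nonexpansive Fy t01 xE.
have [D D_gt0 near_dD] : exists2 D, 0 < D & \forall k \near \oo,
    `|x k.+1 - x k| <= D * (1 / (k%:R + b + 1)).
  (* (b + 1) / b bounds (k + b + 1) / (k + b) *)
  apply: (@recursion_rate _ b ((b + 1) / b * M) t) => // [A|k].
    exact: near_step_mul_ge.
  apply: le_trans
    (halpern_step_le T_nonexpansive (ltW (t_decr _ _ (ltnSn k)))
       (t_lt1 k.+1) (xE k) (xE k.+1)) _.
  have s_gt0 := natD_gt0 b_gt0 k.
  rewrite lerD2l; apply: (@le_trans _ _ (t k.+1 / (k%:R + b) * M)).
    by apply: ler_pM => //; [rewrite subr_ge0 ltW // t_decr|exact: step_sub_le].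
  rewrite -mulrA ler_wpM2l ?(ltW (t_gt0 _)) // [leRHS]mulrAC ler_wpM2r //.
  have k_ge0 : 0 <= k%:R :> R by [].
  rewrite -div1r ler_pdivrMr // mulrAC ler_pdivlMr; last by lra.
  rewrite mulrAC ler_pdivlMr //; nra.
have [z zE] := choice
  (fun k => anchored_point_exists T_nonexpansive v (t_gt0 k) (t_lt1 k)).
have z_cvg := anchored_cvg dotpE T_nonexpansive FixT_neq0 t01 t_decr
  (step_cvg0 q_gt0 a_gt0 b_gt0) zE.
split.
- apply/eqO_exP; exists D => //; near=> k.
  have s_gt0 := natD_gt0 b_gt0 k.
  rewrite normr_id (@ger0_norm _ (1 / _)) ?divr_ge0 //; last by lra.
  by near: k.
- apply/eqO_exP; exists (a * M + D).
    by have := mulr_ge0 (ltW a_gt0) M_ge0; lra.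
  near=> k; rewrite normr_id (@ger0_norm _ (1 / _)) ?divr_ge0 ?powR_ge0 //.
  apply: le_trans (ler_distD (T (x k)) _ _) _; rewrite mulrDl lerD //.
    have -> : x k.+1 - T (x k) = t k *: (v - T (x k)).
      rewrite xE scalerBl scale1r scalerBr -addrA [_ - _ - _]addrAC.
      by rewrite subrr add0r.
    rewrite normrZ (gtr0_norm (t_gt0 k)) div1r [leRHS]mulrAC.
    by apply: (@ler_wpM2l R (t k)) => //; exact: ltW.
  apply: le_trans (T_nonexpansive _ _) _; rewrite distrC.
  apply: (@le_trans _ _ (D * (1 / (k%:R + b + 1)))); first by near: k.
  by rewrite ler_wpM2l ?(ltW D_gt0) // inv_natD1_le.
- suff xz0 : x \- z @ \oo --> (0 : H).
    have -> : x = (x \- z) \+ z by apply/funext => k /=; rewrite subrK.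
    by rewrite -[metric_projection _ _]add0r; exact: cvgD.
  apply/cvgrPdist_le => e e_gt0; near=> k.
  rewrite sub0r normrN /= -(ler_pM2l (t_gt0 k)).
  apply: le_trans
    (dist_anchored_point_le T_nonexpansive (t_lt1 k) (xE k) (zE k)) _.
  have s_gt0 := natD_gt0 b_gt0 k.
  apply: (@le_trans _ _ (D * (1 / (k%:R + b + 1)))); first by near: k.
  rewrite mulrA mulr1 ler_pdivrMr; last by lra.
  have h : D / e <= t k * (k%:R + b) by near: k; exact: near_step_mul_ge.
  rewrite ler_pdivrMr // in h; apply: le_trans h _.
  have := t_gt0 k; nra.
Unshelve. all: by end_near.
Qed.
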